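(* Let $\eta\in(0,1)$. There exist constants $c,C,C'>0$ depending only on $\eta$ such that for every $d\ge1$ and every $\sigma_1\ge\dots\ge\sigma_d>0$ with $\Sigma=\operatorname{diag}(\sigma_1^2,\dots,\sigma_d^2)$, writing $\rho=\max_{1\le i\le d}\sigma_i\sqrt{\log(1+i)}$: 1. (Lower bound) $\epsilon^*(1,\infty,\Sigma)\ \ge\ c\,\max_{1\le i\le d}\sigma_i\sqrt{\log(1+i)}$. 2. (Upper bound) For every $s\in\{1,\dots,d\}$, the test $\widetilde\psi=\mathbf 1\{\max_{1\le i\le d}|X_i|>C\rho\}$ satisfies $$\mathbb P_0(\widetilde\psi=1)\le\eta/2,\qquad\text{and}\qquad\mathbb P_\theta(\widetilde\psi=0)\le\eta/2\ \text{ for every }\theta\in\mathbb R^d\text{ with }\|\theta\|_\infty\ge C'\rho\text{ and }\|\theta\|_0\le s.$$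
   Context: Testing problem. Let $d\ge1$, $\sigma_1\ge\dots\ge\sigma_d>0$ known, $\Sigma=\operatorname{diag}(\sigma_1^2,\dots,\sigma_d^2)$. For $\theta\in\mathbb R^d$, $\mathbb P_\theta$ denotes the law of $X\sim\mathcal N(\theta,\Sigma)$. $\|u\|_\infty=\max_j|u_j|$, $\|u\|_0=\operatorname{Card}\{j:u_j\ne0\}$. For $\epsilon>0$, $s\in\{1,\dots,d\}$: $\Theta(\epsilon,s,\infty)=\{\theta\in\mathbb R^d:\|\theta\|_\infty\ge\epsilon,\ \|\theta\|_0\le s\}$. A test is a measurable $\psi:\mathbb R^d\to\{0,1\}$ of $X$; its risk is $R(\psi,\epsilon,s,\infty,\Sigma)=\mathbb P_0(\psi=1)+\sup_{\theta\in\Theta(\epsilon,s,\infty)}\mathbb P_\theta(\psi=0)$; $R^*=\inf_\psi R$ over all tests; $\epsilon^*(s,\infty,\Sigma)=\inf\{\epsilon>0:R^*(\epsilon,s,\infty,\Sigma)\le\eta\}$. *)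

(* Defs.v *)
From HB Require Import structures.
From mathcomp Require Import all_boot all_order all_algebra.
From mathcomp Require Import all_classical all_reals all_analysis measurable_realfun.

Set Implicit Arguments.
Unset Strict Implicit.
Unset Printing Implicit Defensive.

Import Order.TTheory GRing.Theory Num.Theory.
Import numFieldNormedType.Exports.

Local Open Scope classical_set_scope.
Local Open Scope ring_scope.

Section product_probability.
Context d (T : measurableType d) (R : realType).

Definition cons_pair n (x : T * n.-tuple T) : n.+1.-tuple T :=
  [tuple of x.1 :: x.2].

Lemma measurable_cons_pair n : measurable_fun setT (@cons_pair n).
Proof. by apply: measurable_cons; [exact: measurable_fst|exact: measurable_snd]. Qed.

HB.instance Definition _ n :=
  isMeasurableFun.Build _ _ _ _ (@cons_pair n) (@measurable_cons_pair n).

(* The product of the measures P 0, ..., P (n - 1) on the product sigma-algebra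
   of n.-tuple T, i.e. the joint law of independent components. *)
Fixpoint product_probability n : ('I_n -> probability T R) ->
    probability (n.-tuple T) R :=
  match n with
  | 0 => fun=> \d_ [tuple]
  | n'.+1 => fun P =>
      distribution (P ord0 \x product_probability (P \o lift ord0))%E
        (@cons_pair n')
  end.

Lemma product_probabilityE n (P : 'I_n -> probability T R)
    (A : 'I_n -> set T) : (forall i, measurable (A i)) ->
  product_probability P [set x | forall i, A i (tnth x i)] =
  (\prod_(i < n) P i (A i))%E.
Proof.
elim: n P A => [|n IH] P A mA /=.
  rewrite big_ord0 diracE mem_set//= => -[]//.
have mB : measurable [set x : n.-tuple T | forall i, A (lift ord0 i) (tnth x i)].
  rewrite (_ : [set _ | _] = \bigcap_(i in [set: 'I_n])
      ((fun x : n.-tuple T => tnth x i) @^-1` A (lift ord0 i))).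
    apply: fin_bigcap_measurable => [|i _]; first exact: finite_finset.
    by rewrite -[X in measurable X]setTI; exact: measurable_tnth.
  by apply/seteqP; split=> x h i; [move=> _; exact: h|exact: (h i)].
rewrite big_ord_recl -IH//.
rewrite -product_measure1E//; congr (_ _).
apply/seteqP; split => -[x y] /=.
  by move=> h; split=> [|i]; [have := h ord0 | have := h (lift ord0 i); rewrite tnthS].
by move=> [h0 h] i; case: (unliftP ord0 i) => [j|] ->; rewrite ?tnthS.
Qed.

End product_probability.

Section real_id.
Context (R : realType).

(* normal_prob lives on measurableTypeR R, whose display differs from the one of
   the canonical measurable structure of R; the sigma-algebras coincide. *)
Definition real_id : measurableTypeR R -> R := idfun.

Lemma measurable_real_id : measurable_fun setT real_id.
Proof. exact: measurable_id. Qed.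

HB.instance Definition _ :=
  isMeasurableFun.Build _ _ _ _ real_id measurable_real_id.

Definition normal_law (m s : R) : probability R R :=
  distribution (normal_prob m s) real_id.

Lemma normal_lawE (m s : R) (A : set R) : normal_law m s A = normal_prob m s A.
Proof. by []. Qed.

End real_id.

Section testing.
Context (R : realType) (d : nat).
Implicit Types (sigma : 'I_d -> R) (theta u : d.-tuple R).

(* sigma lists the standard deviations, so this is N(theta, Sigma) with
   Sigma = diag(sigma_j ^ 2). *)
Definition gaussian_law sigma theta : probability (d.-tuple R) R :=
  product_probability (fun j => normal_law (tnth theta j) (sigma j)).

Definition vec0 : d.-tuple R := [tuple 0 | _ < d].

Definition norm_inf u : R := \big[Num.max/0]_(j < d) `|tnth u j|.

Definition norm_zero u : nat := #|[set j | tnth u j != 0]%SET|.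

Definition Theta (eps : R) (s : nat) : set (d.-tuple R) :=
  [set theta | eps <= norm_inf theta /\ (norm_zero theta <= s)%N].

Definition test := {mfun d.-tuple R >-> bool}.

Definition risk (psi : test) (eps : R) (s : nat) sigma : \bar R :=
  (gaussian_law sigma vec0 (psi @^-1` [set true]) +
   ereal_sup [set gaussian_law sigma theta (psi @^-1` [set false])
             | theta in Theta eps s])%E.

Definition minimax_risk (eps : R) (s : nat) sigma : \bar R :=
  ereal_inf [set risk psi eps s sigma | psi in [set: test]].

Definition critical_radius (eta : R) (s : nat) sigma : \bar R :=
  ereal_inf [set eps%:E | eps in
    [set eps : R | 0 < eps /\ (minimax_risk eps s sigma <= eta%:E)%E]].

(* Indices start at 0, so log (1 + i) for i = 1, ..., d becomes ln (i + 2). *)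
Definition rho sigma : R :=
  \big[Num.max/0]_(i < d) (sigma i * Num.sqrt (ln i.+2%:R)).

Definition max_test (t : R) (x : d.-tuple R) : bool := t < norm_inf x.

Lemma measurable_norm_inf : measurable_fun setT norm_inf.
Proof.
rewrite /norm_inf -[measurable_fun _ _]/(measurable_fun setT (fun u => _)).
elim: (index_enum _) => [|i r IH].
  by under eq_fun do rewrite big_nil; exact: measurable_cst.
under eq_fun do rewrite big_cons.
apply: measurable_maxr => //.
by apply: measurableT_comp => //; exact: measurable_tnth.
Qed.

Lemma measurable_max_test t : measurable_fun setT (max_test t).
Proof.
by apply: measurable_fun_ltr; [exact: measurable_cst|exact: measurable_norm_inf].
Qed.

HB.instance Definition _ t :=
  isMeasurableFun.Build _ _ _ _ (max_test t) (measurable_max_test t).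

End testing.

(* Main.v *)
(* Upper bound: a shifted Gaussian density gives P(|X_j - theta_j| >= t) <=
   2 exp(- t^2 / (2 sigma_j^2)), so with C^2 = 2 (k + 2) and the index j
   starting at 0 the j-th coordinate exceeds C rho with probability at most
   2 (j + 2)^-(k + 2); these sum to at most 2^(1 - k).  Under the alternative,
   C' = 2 C leaves a deviation of at least C rho at the largest coordinate.

   Lower bound: let k attain the maximum defining rho (again from 0), let
   n = k + 1, and put the uniform prior on the n spikes eps e_j, j <= k.  Since
   sigma_j >= sigma_k, the chi-square divergence of the mixture from P_0 is at
   most (exp(eps^2 / sigma_k^2) - 1) / n.  For eps <= c rho this is at most
   ((n + 1)^(c^2) - 1) / n, hence at most c^2 by Bernoulli's inequality, and
   every test has risk at least 1 - c. *)

Require Import Defs.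
From HB Require Import structures.
From mathcomp Require Import all_boot all_order all_algebra.
From mathcomp Require Import all_classical all_reals all_analysis.
From mathcomp Require Import measurable_realfun ring lra.

Import Order.TTheory GRing.Theory Num.Theory.
Import numFieldNormedType.Exports.

Local Open Scope classical_set_scope.
Local Open Scope ring_scope.

Set Implicit Arguments.
Unset Strict Implicit.

(** * Integration against densities: general measures, Gaussian laws, products *)

(** The formula for [nu] makes it absolutely continuous, and its Radon-Nikodym derivative agrees
    with [g] almost everywhere because both have the same integral over every measurable set. The
    change of variables for the derivative then transfers to [g]. *)
Lemma ge0_integral_density d (T : measurableType d) (R : realType)
    (nu : {finite_measure set T -> \bar R})
    (mu : {sigma_finite_measure set T -> \bar R}) (g f : T -> \bar R) :
  mu.-integrable setT g ->
  (forall A, measurable A -> nu A = (\int[mu]_(x in A) g x)%E) ->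
  measurable_fun setT f -> (forall x, (0 <= f x)%E) ->
  (\int[nu]_x f x = \int[mu]_x (f x * g x))%E.
Proof.
move=> intg nuE mf f0.
have dom : nu `<< mu.
  apply/null_content_dominatesP => A mA muA0.
  rewrite nuE// null_set_integral//.
  exact: measurable_funTS (measurable_int _ intg).
rewrite -(Radon_Nikodym_SigmaFinite.change_of_variables dom)//.
have intRN := Radon_Nikodym_SigmaFinite.f_integrable dom.
apply: ae_eq_integral => //.
- by apply: emeasurable_funM => //; exact: measurable_int intRN.
- by apply: emeasurable_funM => //; exact: measurable_int intg.
have : ae_eq mu setT (Radon_Nikodym_SigmaFinite.f nu mu) g.
  apply: integral_ae_eq => //; first exact: measurable_int intg.
  by move=> A _ mA; rewrite -nuE// -Radon_Nikodym_SigmaFinite.f_integral.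
by apply: filterS => x /= /(_ I) ->.
Qed.

Lemma ge0_integral_normal_law (R : realType) (m s : R) (f : R -> \bar R) :
  measurable_fun setT f -> (forall x, (0 <= f x)%E) ->
  (\int[normal_law m s]_x f x =
   \int[@lebesgue_measure R]_x (f x * (normal_pdf m s x)%:E))%E.
Proof.
move=> mf f0.
have mf' : measurable_fun [set: measurableTypeR R] (f \o @real_id R).
  by apply: measurableT_comp => //; exact: measurable_real_id.
rewrite ge0_integral_distribution//.
by rewrite (ge0_integral_density (mu := lebesgue_measure)
  (g := fun x => (normal_pdf m s x)%:E))//; exact: integrable_normal_pdf.
Qed.

(** Likelihood ratio of N(m, s^2) to N(0, s^2) at [x]. *)
Definition tilt (R : realType) (m s x : R) : R :=
  expR (m * x / s ^+ 2 - m ^+ 2 / (s ^+ 2 *+ 2)).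

Lemma measurable_tilt (R : realType) (m s : R) :
  measurable_fun setT (tilt m s).
Proof.
apply: measurableT_comp => //; apply: measurable_funB => //.
by apply: measurable_funM => //; exact: measurable_funM.
Qed.

Lemma normal_pdf_tilt (R : realType) (m s x : R) : s != 0 ->
  normal_pdf m s x = tilt m s x * normal_pdf 0 s x.
Proof.
move=> s0; rewrite !normal_pdfE// /normal_fun /tilt mulrCA -expRD.
by congr (_ * expR _); field.
Qed.

Lemma ge0_integral_normal_law_tilt (R : realType) (m s : R) (f : R -> \bar R) :
  s != 0 -> measurable_fun setT f -> (forall x, (0 <= f x)%E) ->
  (\int[normal_law m s]_x f x =
   \int[normal_law 0 s]_x (f x * (tilt m s x)%:E))%E.
Proof.
move=> s0 mf f0; rewrite (ge0_integral_normal_law _ _ mf f0).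
rewrite ge0_integral_normal_law; first last.
- by move=> x; rewrite mule_ge0// lee_fin expR_ge0.
- by apply: emeasurable_funM => //; apply/measurable_EFinP; exact: measurable_tilt.
by apply: eq_integral => x _; rewrite normal_pdf_tilt// EFinM muleA.
Qed.

Lemma ge0_integral_product_probability d (T : measurableType d) (R : realType) n
    (P : 'I_n.+1 -> probability T R) (f : n.+1.-tuple T -> \bar R) :
  measurable_fun setT f -> (forall x, (0 <= f x)%E) ->
  (\int[product_probability P]_x f x =
   \int[P ord0]_x \int[product_probability (P \o lift ord0)]_y
     f [tuple of x :: y])%E.
Proof.
move=> mf f0; rewrite /= ge0_integral_distribution//.
rewrite fubini_tonelli1//; last by move=> x; exact: f0.
by apply: measurableT_comp => //; exact: measurable_cons_pair.
Qed.

(** Induction on [n]: Tonelli isolates the first coordinate, the induction hypothesis changes the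
    law of the others while it is held fixed, and [QE] changes the law of the first. The hypothesis
    on [g] is stated for integrals of functions because the inner integral is the integrand at this
    last step. *)
Lemma ge0_integral_product_density d (T : measurableType d) (R : realType) n
    (P Q : 'I_n -> probability T R) (g : 'I_n -> T -> R) (f : n.-tuple T -> \bar R) :
  (forall i, measurable_fun setT (g i)) -> (forall i x, 0 <= g i x) ->
  (forall i (h : T -> \bar R), measurable_fun setT h -> (forall x, (0 <= h x)%E) ->
    (\int[Q i]_x h x = \int[P i]_x (h x * (g i x)%:E))%E) ->
  measurable_fun setT f -> (forall x, (0 <= f x)%E) ->
  (\int[product_probability Q]_x f x =
   \int[product_probability P]_x (f x * (\prod_(i < n) g i (tnth x i))%:E))%E.
Proof.
move=> mg g0; elim: n P Q g mg g0 f => [|n IH] P Q g mg g0 f QE mf f0.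
  by apply: eq_integral => x _; rewrite big_ord0 mule1.
have mcons x : measurable_fun setT (fun y : n.-tuple T => [tuple of x :: y]).
  exact: measurable_cons.
have mprod : measurable_fun setT
    (fun x : n.-tuple T => (\prod_(i < n) g (lift ord0 i) (tnth x i))%:E).
  apply/measurable_EFinP; apply: measurable_prod => i _.
  by apply: measurableT_comp => //; exact: measurable_tnth.
have mprod' : measurable_fun setT
    (fun x : n.+1.-tuple T => (\prod_(i < n.+1) g i (tnth x i))%:E).
  apply/measurable_EFinP; apply: measurable_prod => i _.
  by apply: measurableT_comp => //; exact: measurable_tnth.
rewrite !ge0_integral_product_probability//; last 2 first.
- exact: emeasurable_funM.
- by move=> x; rewrite mule_ge0// lee_fin prodr_ge0.
under eq_integral => x _ do rewrite (IH (P \o lift ord0) (Q \o lift ord0)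
  (fun i => g (lift ord0 i)) _ _ (fun y => f [tuple of x :: y]) (fun i => QE (lift ord0 i))
  (measurableT_comp mf (mcons x)))//.
rewrite QE//; last 2 first.
(* The inner integral is measurable in the first coordinate, as a section integral of a jointly
   measurable nonnegative function. *)
- apply: (measurable_fun_fubini_tonelli_F
    (fun z : T * n.-tuple T => f (cons_pair z) *
       (\prod_(i < n) g (lift ord0 i) (tnth z.2 i))%:E)%E).
    apply: emeasurable_funM; first by apply: measurableT_comp => //; exact: measurable_cons_pair.
    exact: (measurableT_comp mprod).
  by move=> z; rewrite mule_ge0// lee_fin prodr_ge0.
- by move=> x; apply: integral_ge0 => y _; rewrite mule_ge0// lee_fin prodr_ge0.
apply: eq_integral => x _.
rewrite -ge0_integralZr//; last 3 first.
- by apply: emeasurable_funM => //; exact: measurableT_comp.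
- by move=> y _; rewrite mule_ge0// lee_fin prodr_ge0.
- by rewrite lee_fin.
apply: eq_integral => y _.
rewrite -muleA -EFinM big_ord_recl mulrC.
by congr (_ * (_ * _)%:E)%E; apply: eq_bigr => i _; rewrite tnthS.
Qed.

(** * Gaussian tails and the two error probabilities of the maximum test *)

Lemma measurable_set_ler d (T : measurableType d) (R : realType) (f g : T -> R) :
  measurable_fun setT f -> measurable_fun setT g ->
  measurable [set x | f x <= g x].
Proof.
by move=> mf mg; rewrite -[X in measurable X]setTI; exact: measurable_fun_ler.
Qed.

Lemma measure_bigsetU_le d (T : ringOfSetsType d) (R : realType)
    (mu : {measure set T -> \bar R}) (I : Type) (r : seq I) (A : I -> set T) :
  (forall i, measurable (A i)) ->
  (mu (\big[setU/set0]_(i <- r) A i) <= \sum_(i <- r) mu (A i))%E.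
Proof.
move=> mA; elim: r => [|i r IH]; first by rewrite !big_nil measure0.
rewrite !big_cons (le_trans (measureU2 _ _ _))//; first exact: bigsetU_measurable.
exact: leeD.
Qed.

(** Moving the centre by [b] changes the squared distance by (x - m)^2 - (x - m - b)^2 = 2 b (x - m)
    - b^2, which is at least b^2 under the hypothesis. *)
Lemma normal_pdf_shift (R : realType) (m s b x : R) : s != 0 ->
  b ^+ 2 <= b * (x - m) ->
  normal_pdf m s x <= expR (- (b ^+ 2 / (s ^+ 2 *+ 2))) * normal_pdf (m + b) s x.
Proof.
move=> s0 hx; rewrite !normal_pdfE// /normal_fun mulrCA -expRD.
rewrite ler_wpM2l ?normal_peak_ge0// ler_expR.
rewrite -[X in _ <= X + _]mulNr -mulrDl.
by rewrite ler_wpM2r ?invr_ge0 ?mulrn_wge0 ?sqr_ge0//; nra.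
Qed.

(* The sign of b selects the tail. *)
Lemma normal_law_half_tail (R : realType) (m s b : R) : s != 0 ->
  (normal_law m s [set x | (b ^+ 2 <= b * (x - m))%R] <=
   (expR (- (b ^+ 2 / (s ^+ 2 *+ 2))))%:E)%E.
Proof.
move=> s0; rewrite normal_lawE /normal_prob.
set A := [set x | _]; set e := expR _.
have mA : measurable (A : set (measurableTypeR R)).
  apply: measurable_set_ler => //; apply: measurable_funM => //.
  exact: measurable_funB.
have mpdf n : measurable_fun [set: measurableTypeR R]
    (fun x => (normal_pdf n s x)%:E).
  by apply/measurable_EFinP; exact: measurable_normal_pdf.
apply: (@le_trans _ _ (\int[lebesgue_measure]_(x in A)
    (e%:E * (normal_pdf (m + b) s x)%:E)))%E.
  apply: ge0_le_integral => //.
  - by move=> x _; rewrite lee_fin normal_pdf_ge0.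
  - exact: measurable_funTS.
  - by apply: measurable_funTS; exact: emeasurable_funM.
  - by move=> x Ax; rewrite -EFinM lee_fin normal_pdf_shift.
rewrite ge0_integralZl//; last 3 first.
- exact: measurable_funTS.
- by move=> x _; rewrite lee_fin normal_pdf_ge0.
- by rewrite lee_fin expR_ge0.
rewrite -[leRHS]mule1 lee_wpmul2l ?lee_fin ?expR_ge0//.
rewrite -(integral_normal_pdf (m + b) s) ge0_subset_integral//.
by move=> x _; rewrite lee_fin normal_pdf_ge0.
Qed.

Lemma normal_law_tail (R : realType) (m s t : R) : s != 0 -> 0 <= t ->
  (normal_law m s [set x | (t <= `|x - m|)%R] <=
   (2 * expR (- (t ^+ 2 / (s ^+ 2 *+ 2))))%:E)%E.
Proof.
move=> s0 t0.
pose A b : set R := [set x | b ^+ 2 <= b * (x - m)].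
have mA b : measurable (A b).
  apply: measurable_set_ler => //; apply: measurable_funM => //.
  exact: measurable_funB.
apply: (@le_trans _ _ (normal_law m s (A t `|` A (- t)))); last first.
  rewrite (le_trans (measureU2 _ (mA t) (mA (- t))))// mulrDl mul1r EFinD leeD//.
    exact: normal_law_half_tail.
  by rewrite -(sqrrN t); exact: normal_law_half_tail.
apply: le_measure; rewrite ?inE//.
- apply: measurable_set_ler => //; apply: measurableT_comp => //.
  exact: measurable_funB.
- exact: measurableU.
- move=> x; rewrite /A /= sqrrN ler_normr => /orP[] h; [left|right]; nra.
Qed.

Lemma gaussian_law_coord (R : realType) d (sigma : 'I_d -> R) theta (j : 'I_d)
    (A : set R) : measurable A ->
  gaussian_law sigma theta [set x | A (tnth x j)] =
  normal_law (tnth theta j) (sigma j) A.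
Proof.
(* The event is a rectangle whose sides are the whole line except at [j], so the product formula
   leaves a single factor. *)
move=> mA; pose B i := if i == j then A else setT.
rewrite [X in gaussian_law _ _ X](_ : _ = [set x | forall i, B i (tnth x i)]).
  rewrite product_probabilityE; last by move=> i; rewrite /B; case: ifP.
  rewrite (bigD1 j)//= {1}/B eqxx big1 ?mule1// => i ij.
  by rewrite /B (negbTE ij) probability_setT.
apply/seteqP; split=> x /=; last by move/(_ j); rewrite /B eqxx.
by rewrite /B => Ax i; case: eqVneq => // ->.
Qed.

Lemma rho_ge (R : realType) d (sigma : 'I_d -> R) (j : 'I_d) :
  sigma j * Num.sqrt (ln j.+2%:R) <= rho sigma.
Proof. exact: (le_bigmax 0 (fun j : 'I_d => sigma j * Num.sqrt (ln j.+2%:R))). Qed.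

Lemma gaussian_law_coord_tail (R : realType) d (sigma : 'I_d -> R) theta
    (j : 'I_d) (k : nat) : 0 < sigma j ->
  (gaussian_law sigma theta
     [set x | (Num.sqrt (k * 2)%:R * rho sigma <= `|tnth x j - tnth theta j|)%R] <=
   (2 * (j.+2%:R ^- k))%:E)%E.
Proof.
move=> s0; set t := Num.sqrt _ * _.
have l0 : 0 <= ln (j.+2%:R : R) by rewrite ln_ge0// ler1n.
have r0 : 0 <= rho sigma.
  by apply: le_trans _ (rho_ge sigma j); rewrite mulr_ge0 ?sqrtr_ge0 ?ltW.
have t0 : 0 <= t by rewrite mulr_ge0 ?sqrtr_ge0.
rewrite (@gaussian_law_coord _ _ sigma theta j [set x | t <= `|x - tnth theta j|]).
  apply: le_trans (normal_law_tail _ _ _) _ => //; first by rewrite gt_eqF.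
  rewrite lee_fin ler_wpM2l// -[j.+2%:R]lnK ?posrE// -expRM_natl -expRN.
  rewrite ler_expR lerN2 -(mulr_natr (_ ^+ 2)) -[_ *+ k]mulr_natl.
  rewrite ler_pdivlMr ?mulr_gt0 ?exprn_gt0//.
  (* With t^2 = 2 k rho^2, this gives t^2 / (2 sigma_j^2) >= k ln(j + 2), the exponent of (j +
     2)^-k. *)
  have rho2 : sigma j ^+ 2 * ln j.+2%:R <= rho sigma ^+ 2.
    rewrite -[ln _]sqr_sqrtr// -exprMn ler_sqr ?nnegrE//; first exact: rho_ge.
    by rewrite mulr_ge0 ?sqrtr_ge0 ?ltW.
  rewrite /t exprMn sqr_sqrtr// natrM.
  rewrite [leLHS](_ : _ = k%:R * 2 * (sigma j ^+ 2 * ln j.+2%:R)); last by ring.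
  by rewrite ler_wpM2l// mulr_ge0.
apply: measurable_set_ler => //; apply: measurableT_comp => //.
exact: measurable_funB.
Qed.

(** Telescoping: with a = d + 1, the slack 1/a - 1/(a + 1) - 1/(a + 1)^2 equals 1/(a (a + 1)^2). The
    subtracted term is what carries the induction. *)
Lemma sum_inv_sqr_le1 (R : realFieldType) (d : nat) :
  \sum_(j < d) (j.+2%:R : R) ^- 2 <= 1 - d.+1%:R^-1.
Proof.
elim: d => [|d IH]; first by rewrite big_ord0 invr1 subrr.
rewrite big_ord_recr/= (le_trans (lerD IH (lexx _)))//.
rewrite -[d.+2%:R]natr1; set a : R := d.+1%:R.
have a0 : 0 < a by rewrite ltr0n.
rewrite -subr_ge0.
rewrite (_ : _ - _ = (a * (a + 1) ^+ 2)^-1); last by field; lra.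
by rewrite invr_ge0 mulr_ge0 ?sqr_ge0 ?ltW.
Qed.

Lemma max_test_type1 (R : realType) d (sigma : 'I_d -> R) (k : nat) :
  (forall i, 0 < sigma i) ->
  (gaussian_law sigma (vec0 R d)
     (max_test (Num.sqrt (k.+2 * 2)%:R * rho sigma) @^-1` [set true]) <=
   (2 * 2 ^- k)%:E)%E.
Proof.
move=> s0; set t := Num.sqrt _ * _.
have t0 : 0 <= t by rewrite mulr_ge0 ?sqrtr_ge0//; exact: bigmax_ge_id.
have mA (j : 'I_d) : measurable
    [set x : d.-tuple R | t <= `|tnth x j - tnth (vec0 R d) j| ].
  apply: measurable_set_ler => //; apply: measurableT_comp => //.
  by apply: measurable_funB => //; exact: measurable_tnth.
apply: (@le_trans _ _ (gaussian_law sigma (vec0 R d) (\big[setU/set0]_(j < d)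
   [set x : d.-tuple R | t <= `|tnth x j - tnth (vec0 R d) j| ]))).
  apply: le_measure; rewrite ?inE.
  - rewrite -[X in measurable X]setTI.
    by apply: (measurable_max_test t measurableT (_ : measurable [set true])).
  - exact: bigsetU_measurable.
  (* The maximum in [norm_inf] starts from 0, which cannot exceed t >= 0, so some coordinate
     does. *)
  - move=> x /= /bigmax_gtP[|[j _ tj]]; first by rewrite ltNge t0.
    rewrite -bigcup_seq; exists j; first by rewrite /= mem_index_enum.
    by rewrite /= tnth_mktuple subr0 ltW.
apply: le_trans (measure_bigsetU_le _ _ mA) _.
apply: (@le_trans _ _ (\sum_(j < d) (2 * 2 ^- k * j.+2%:R ^- 2)%:E))%E.
  apply: lee_sum => j _; apply: le_trans (gaussian_law_coord_tail _ _ _) _ => //.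
  (* Of the k + 2 powers of 1/(j + 2), two are kept for summability and the other k are bounded by
     2^-k. *)
  rewrite lee_fin -mulrA ler_wpM2l// -(addn2 k) exprD invfM.
  rewrite ler_wpM2r ?invr_ge0 ?exprn_ge0//.
  by rewrite lef_pV2 ?posrE ?exprn_gt0// lerXn2r ?nnegrE// ler_nat.
rewrite sumEFin lee_fin -mulr_sumr ler_piMr ?mulr_ge0 ?invr_ge0 ?exprn_ge0//.
by apply: le_trans (sum_inv_sqr_le1 R d) _; rewrite gerBl.
Qed.

(** One coordinate suffices: if [j] attains the norm of [theta], then |theta_j| >= 2 t and |x_j| <=
    t force a deviation of at least t at [j]. *)
Lemma max_test_type2 (R : realType) d (sigma : 'I_d -> R) (k : nat) theta :
  (0 < d)%N -> (forall i, 0 < sigma i) ->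
  2 * Num.sqrt (k.+2 * 2)%:R * rho sigma <= norm_inf theta ->
  (gaussian_law sigma theta
     (max_test (Num.sqrt (k.+2 * 2)%:R * rho sigma) @^-1` [set false]) <=
   (2 * 2 ^- k)%:E)%E.
Proof.
case: d sigma theta => // d sigma theta _ s0; rewrite -mulrA; set t := Num.sqrt _ * _.
move=> htheta.
have [j _ jE] := @eq_bigmax _ _ _ 0 (ord0 : 'I_d.+1) xpredT
  (fun j => `|tnth theta j|) isT (fun _ _ => normr_ge0 _).
apply: le_trans (_ : _ <= (2 * j.+2%:R ^- k.+2)%:E)%E _; last first.
  rewrite lee_fin ler_wpM2l// lef_pV2 ?posrE ?exprn_gt0//.
  apply: (@le_trans _ _ (2 ^+ k.+2)); first by rewrite ler_weXn2l ?ler1n// ltnW.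
  by rewrite lerXn2r ?nnegrE// ler_nat.
apply: le_trans _ (gaussian_law_coord_tail theta k.+2 (s0 j)).
apply: le_measure; rewrite ?inE.
- rewrite -[X in measurable X]setTI.
  by apply: (measurable_max_test t measurableT (_ : measurable [set false])).
- apply: measurable_set_ler => //; apply: measurableT_comp => //.
  by apply: measurable_funB => //; exact: measurable_tnth.
- move=> x /= /negbT; rewrite -leNgt => xt.
  have xj : `|tnth x j| <= t by apply: le_trans xt; exact: le_bigmax.
  rewrite distrC; apply: le_trans _ (lerB_dist _ _).
  by rewrite lerBrDr (le_trans (lerD (lexx t) xj))//; move: htheta; rewrite /norm_inf jE; lra.
Qed.

(** * Testing against a mixture through the second moment of the likelihood ratio *)

(** [L] is the density of the alternative, [B] the acceptance region, and the second-moment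
    hypothesis says that the chi-square divergence is at most c^2. A pointwise quadratic inequality
    with weight [c] replaces Cauchy-Schwarz. *)
Lemma second_moment_testing d (T : measurableType d) (R : realType)
    (P : probability T R) (L : T -> R) (c : R) (B : set T) :
  measurable_fun setT L -> (forall x, 0 <= L x) -> 0 < c -> measurable B ->
  (\int[P]_x (L x)%:E = 1)%E ->
  (\int[P]_x (L x ^+ 2)%:E <= (1 + c ^+ 2)%:E)%E ->
  ((1 - c)%:E <= P (~` B) + \int[P]_x ((\1_B x)%:E * (L x)%:E))%E.
Proof.
move=> mL L0 c0 mB L1 L2.
have mB1 : measurable_fun setT (fun x => (\1_B x : R)%:E).
  by apply/measurable_EFinP; exact: measurable_indic.
have mLE : measurable_fun setT (fun x => (L x)%:E) by exact/measurable_EFinP.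
have mL2 : measurable_fun setT (fun x => (L x ^+ 2)%:E).
  by apply/measurable_EFinP; exact: measurable_funX.
have mBL : measurable_fun setT (fun x => (\1_B x)%:E * (L x)%:E)%E.
  exact: emeasurable_funM.
have B0 x : (0 <= (\1_B x : R)%:E)%E by rewrite lee_fin.
have LE0 x : (0 <= (L x)%:E)%E by rewrite lee_fin.
have L20 x : (0 <= (L x ^+ 2)%:E)%E by rewrite lee_fin sqr_ge0.
have BL0 x : (0 <= (\1_B x)%:E * (L x)%:E)%E by rewrite mule_ge0.
have c0E : (0 <= (2 * c)%:E)%E by rewrite lee_fin mulr_ge0// ltW.
set q := (\int[P]_x (_ * _))%E.
have q0 : (0 <= q)%E by exact: integral_ge0.
have q1 : (q <= 1)%E.
  rewrite -L1; apply: ge0_le_integral => // x _.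
  by rewrite -EFinM lee_fin ler_piMl// indicE; case: (_ \in _).
have qfin : q \is a fin_num by rewrite ge0_fin_numE// (le_lt_trans q1)// ltry.
have Bfin : P B \is a fin_num by exact: fin_num_measure.
have m1 : measurable_fun setT (fun x => (2 * c)%:E * (\1_B x)%:E)%E.
  exact: emeasurable_funM.
have m2 : measurable_fun setT (fun x => 2%:E * (L x)%:E)%E.
  exact: emeasurable_funM.
have m3 : measurable_fun setT (fun x => (2 * c)%:E * ((\1_B x)%:E * (L x)%:E))%E.
  exact: emeasurable_funM.
have p1 x : [set: T] x -> (0 <= (2 * c)%:E * (\1_B x)%:E)%E by rewrite mule_ge0.
have p2 x : [set: T] x -> (0 <= 2%:E * (L x)%:E)%E by rewrite mule_ge0// lee_fin.
have p3 x : [set: T] x -> (0 <= (2 * c)%:E * ((\1_B x)%:E * (L x)%:E))%E.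
  by rewrite mule_ge0.
have p4 x : [set: T] x ->
    (0 <= (L x ^+ 2)%:E + (2 * c)%:E * ((\1_B x)%:E * (L x)%:E))%E.
  by rewrite adde_ge0// mule_ge0.
(* All terms are arranged to be nonnegative on both sides, so that the integrals split
   additively. *)
have key : (\int[P]_x ((2 * c)%:E * (\1_B x)%:E + 2%:E * (L x)%:E) <=
    \int[P]_x ((1 + c ^+ 2)%:E + ((L x ^+ 2)%:E +
      (2 * c)%:E * ((\1_B x)%:E * (L x)%:E))))%E.
  apply: ge0_le_integral => //.
  - by move=> x _; rewrite adde_ge0// mule_ge0// lee_fin.
  - exact: emeasurable_funD.
  - by apply: emeasurable_funD => //; exact: emeasurable_funD.
  - (* (1 - L - c)^2 >= 0 on B and (1 - L)^2 >= 0 off B *)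
    move=> x _; rewrite -!EFinM -!EFinD lee_fin indicE.
    case: (x \in B) => /=; last by have := sqr_ge0 (1 - L x); nra.
    by have := sqr_ge0 (1 - L x - c); nra.
move: key; rewrite ge0_integralD// (@ge0_integralD _ _ _ _ _ _ (cst _))//; last 2 first.
- by move=> x _; rewrite lee_fin addr_ge0// sqr_ge0.
- exact: emeasurable_funD.
rewrite ge0_integralD//.
rewrite !ge0_integralZl// integral_cst//= probability_setT mule1.
rewrite integral_indic//= setIT L1 -/q => key.
have {}key := le_trans key (leeD (lexx _) (leeD L2 (lexx _))).
rewrite probability_setC//; move: key.
rewrite -(fineK qfin) -(fineK Bfin) -!EFinM -!EFinD !lee_fin => key.
(* [key] now reads 2 c P(B) + 2 <= 2 (1 + c^2) + 2 c q; dividing by 2 c gives P(B) <= c + q. *)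
by rewrite -(ler_pM2l c0); nra.
Qed.

(** Likelihood ratio of N(theta, Sigma) to the null law N(0, Sigma). *)
Definition likelihood (R : realType) d (sigma : 'I_d -> R)
    (theta x : d.-tuple R) : R :=
  \prod_(i < d) tilt (tnth theta i) (sigma i) (tnth x i).

Lemma likelihood_ge0 (R : realType) d (sigma : 'I_d -> R) theta x :
  0 <= likelihood sigma theta x.
Proof. by apply: prodr_ge0 => i _; exact: expR_ge0. Qed.

Lemma measurable_likelihood (R : realType) d (sigma : 'I_d -> R) theta :
  measurable_fun setT (likelihood sigma theta).
Proof.
apply: measurable_prod => i _.
by apply: measurableT_comp; [exact: measurable_tilt|exact: measurable_tnth].
Qed.

Lemma ge0_integral_gaussian_law (R : realType) d (sigma : 'I_d -> R) theta
    (f : d.-tuple R -> \bar R) : (forall i, sigma i != 0) ->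
  measurable_fun setT f -> (forall x, (0 <= f x)%E) ->
  (\int[gaussian_law sigma theta]_x f x =
   \int[gaussian_law sigma (vec0 R d)]_x (f x * (likelihood sigma theta x)%:E))%E.
Proof.
move=> s0 mf f0.
pose P theta i := normal_law (tnth theta i) (sigma i).
apply: (@ge0_integral_product_density _ R R d (P (vec0 R d)) (P theta)
  (fun i => tilt (tnth theta i) (sigma i)) f _ _ _ mf f0).
- by move=> i; exact: measurable_tilt.
- by move=> i x; exact: expR_ge0.
- move=> i h mh h0; rewrite /P tnth_mktuple.
  exact: ge0_integral_normal_law_tilt.
Qed.

Lemma likelihood_gaussian_law (R : realType) d (sigma : 'I_d -> R) theta A :
  (forall i, sigma i != 0) -> measurable A ->
  (\int[gaussian_law sigma (vec0 R d)]_x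
     ((\1_A x)%:E * (likelihood sigma theta x)%:E) = gaussian_law sigma theta A)%E.
Proof.
move=> s0 mA; rewrite -ge0_integral_gaussian_law//.
- by rewrite integral_indic// setIT.
- by apply/measurable_EFinP; exact: measurable_indic.
Qed.

Lemma integral_likelihood (R : realType) d (sigma : 'I_d -> R) theta :
  (forall i, sigma i != 0) ->
  (\int[gaussian_law sigma (vec0 R d)]_x (likelihood sigma theta x)%:E = 1)%E.
Proof.
move=> s0; rewrite -(probability_setT (gaussian_law sigma theta)).
rewrite -likelihood_gaussian_law//; apply: eq_integral => x _.
by rewrite indicT mul1e.
Qed.

Lemma tiltM (R : realType) (m m' s x : R) : s != 0 ->
  tilt m s x * tilt m' s x = expR (m * m' / s ^+ 2) * tilt (m + m') s x.
Proof. by move=> s0; rewrite /tilt -!expRD; congr expR; field. Qed.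

(** The product of the likelihood ratios at [theta] and [theta'] is a constant times the one at
    their sum, which integrates to 1. *)
Lemma integral_likelihoodM (R : realType) d (sigma : 'I_d -> R) theta theta' :
  (forall i, sigma i != 0) ->
  (\int[gaussian_law sigma (vec0 R d)]_x
     (likelihood sigma theta x * likelihood sigma theta' x)%:E =
   (expR (\sum_(i < d) tnth theta i * tnth theta' i / sigma i ^+ 2))%:E)%E.
Proof.
move=> s0.
pose sum := [tuple tnth theta i + tnth theta' i | i < d].
have E x : likelihood sigma theta x * likelihood sigma theta' x =
    expR (\sum_(i < d) tnth theta i * tnth theta' i / sigma i ^+ 2) *
    likelihood sigma sum x.
  rewrite expR_sum /likelihood -!big_split/=; apply: eq_bigr => i _.
  by rewrite tiltM// tnth_mktuple.
under eq_integral => x _ do rewrite E EFinM.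
rewrite ge0_integralZl ?lee_fin ?expR_ge0//.
- by rewrite integral_likelihood// mule1.
- by apply/measurable_EFinP; exact: measurable_likelihood.
- by move=> x _; rewrite lee_fin likelihood_ge0.
Qed.

(** The averaged likelihood ratio [L] is the density of the uniform mixture; expanding its square
    turns the double-sum hypothesis into the second-moment bound of [second_moment_testing]. *)
Lemma mixture_testing (R : realType) d (sigma : 'I_d -> R) n
    (theta : 'I_n -> d.-tuple R) (c : R) (A : set (d.-tuple R)) :
  (0 < n)%N -> (forall i, sigma i != 0) -> 0 < c -> measurable A ->
  \sum_(a < n) \sum_(b < n)
    expR (\sum_(i < d) tnth (theta a) i * tnth (theta b) i / sigma i ^+ 2) <=
    (1 + c ^+ 2) * n%:R ^+ 2 ->
  ((1 - c)%:E <= gaussian_law sigma (vec0 R d) (~` A) +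
     (n%:R^-1)%:E * \sum_(a < n) gaussian_law sigma (theta a) A)%E.
Proof.
move=> n0 s0 c0 mA chi2; set P := gaussian_law sigma (vec0 R d).
have nR : 0 < n%:R :> R by rewrite ltr0n.
pose l a := likelihood sigma (theta a).
have ml a : measurable_fun setT (l a) by exact: measurable_likelihood.
have mlE a : measurable_fun setT (fun x => (l a x)%:E) by exact/measurable_EFinP.
have l0 a x : 0 <= l a x by exact: likelihood_ge0.
have V0 : 0 <= n%:R^-1 :> R by rewrite invr_ge0 ltW.
pose L x := n%:R^-1 * \sum_(a < n) l a x.
have L0 x : 0 <= L x by rewrite mulr_ge0// sumr_ge0.
have mL : measurable_fun setT L.
  by apply: measurable_funM => //; apply: measurable_sum => a.
have LE x : (L x)%:E = ((n%:R^-1)%:E * \sum_(a < n) (l a x)%:E)%E.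
  by rewrite sumEFin EFinM.
have intL : (\int[P]_x (L x)%:E = 1)%E.
  under eq_integral => x _ do rewrite LE.
  rewrite ge0_integralZl//; last 2 first.
  - exact: emeasurable_sum.
  - by move=> x _; apply: sume_ge0 => a _; rewrite lee_fin.
  rewrite ge0_integral_sum//; last by move=> a x _; rewrite lee_fin.
  under eq_bigr => a _ do rewrite integral_likelihood//.
  by rewrite sumEFin -EFinM sumr_const card_ord mulVf// gt_eqF.
have intL2 : (\int[P]_x (L x ^+ 2)%:E <= (1 + c ^+ 2)%:E)%E.
  have L2E x : (L x ^+ 2)%:E = ((n%:R ^- 2)%:E *
      \sum_(a < n) \sum_(b < n) (l a x * l b x)%:E)%E.
    under eq_bigr => a _ do rewrite sumEFin.
    rewrite sumEFin -EFinM /L exprMn exprVn; congr (_ * _)%:E.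
    by rewrite expr2 mulr_suml; apply: eq_bigr => a _; rewrite mulr_sumr.
  have mll a b : measurable_fun setT (fun x => (l a x * l b x)%:E).
    by apply/measurable_EFinP; exact: measurable_funM.
  have ll0 a b x : (0 <= (l a x * l b x)%:E)%E by rewrite lee_fin mulr_ge0.
  under eq_integral => x _ do rewrite L2E.
  rewrite ge0_integralZl//; last 2 first.
  - by apply: emeasurable_sum => a; exact: emeasurable_sum.
  - by move=> x _; apply: sume_ge0 => a _; exact: sume_ge0.
  rewrite ge0_integral_sum//; last 2 first.
  - by move=> a; exact: emeasurable_sum.
  - by move=> a x _; exact: sume_ge0.
  under eq_bigr => a _.
    rewrite ge0_integral_sum//.
    under eq_bigr => b _ do rewrite integral_likelihoodM//.
    rewrite sumEFin; over.
  by rewrite sumEFin -EFinM lee_fin mulrC ler_pdivrMr// exprn_gt0.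
apply: le_trans (second_moment_testing mL L0 c0 mA intL intL2) _.
(* The remaining terms are equal: integrating [L] over [A] averages the probabilities of [A]. *)
rewrite leeD2l// le_eqVlt; apply/orP; left; apply/eqP.
under eq_integral => x _ do rewrite LE muleCA.
have mA1 : measurable_fun setT (fun x => (\1_A x : R)%:E).
  by apply/measurable_EFinP; exact: measurable_indic.
rewrite ge0_integralZl//; last 2 first.
- by apply: emeasurable_funM => //; exact: emeasurable_sum.
- by move=> x _; rewrite mule_ge0 ?lee_fin// sume_ge0// => a _; rewrite lee_fin.
congr (_ * _)%E.
under eq_integral => x _.
  rewrite ge0_sume_distrr; last by move=> a _; rewrite lee_fin.
  over.
rewrite ge0_integral_sum//; last 2 first.
- by move=> a; exact: emeasurable_funM.
- by move=> a x _; rewrite mule_ge0 ?lee_fin.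
by apply: eq_bigr => a _; rewrite likelihood_gaussian_law.
Qed.

(** * Spike alternatives and the lower bound on the critical radius *)

(** Bernoulli's inequality (1 + x)^a <= 1 + a x, from convexity of exp between 0 and ln(1 + x). *)
Lemma expR_ln1D_le (R : realType) (a x : R) : 0 <= a -> a <= 1 -> 0 <= x ->
  expR (a * ln (1 + x)) <= 1 + a * x.
Proof.
move=> a0 a1 x0; pose t := Itv01 a0 a1.
have := @convex_expR R t (ln (1 + x)) 0.
rewrite !convRE/= mulr0 addr0 expR0 lnK ?posrE; last by lra.
by rewrite /unstable.onem => h; apply: le_trans h _; lra.
Qed.

Definition spike (R : realType) d (eps : R) (j : 'I_d) : d.-tuple R :=
  [tuple if i == j then eps else 0 | i < d].

Lemma Theta_spike (R : realType) d (eps : R) (j : 'I_d) : Theta eps 1 (spike eps j).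
Proof.
split.
  apply: le_trans (ler_norm eps) _.
  have := le_bigmax 0 (fun i => `|tnth (spike eps j) i|) j.
  by rewrite tnth_mktuple eqxx.
rewrite /norm_zero -(cards1 j) subset_leq_card//; apply/fintype.subsetP => i.
by rewrite !inE tnth_mktuple; case: (i == j) => //; rewrite eqxx.
Qed.

Lemma spike_dot (R : realType) d (sigma : 'I_d -> R) (eps : R) (j l : 'I_d) :
  \sum_(i < d) tnth (spike eps j) i * tnth (spike eps l) i / sigma i ^+ 2 =
  if j == l then eps ^+ 2 / sigma j ^+ 2 else 0.
Proof.
rewrite (bigD1 j)//= big1 ?addr0 => [|i /negbTE ij]; last first.
  by rewrite tnth_mktuple ij !mul0r.
rewrite !tnth_mktuple eqxx; case: eqVneq => // _.
by rewrite mulr0 mul0r.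
Qed.

Lemma rho_attained (R : realType) d (sigma : 'I_d -> R) :
  (0 < d)%N -> (forall i, 0 < sigma i) ->
  exists k : 'I_d, rho sigma = sigma k * Num.sqrt (ln k.+2%:R).
Proof.
case: d sigma => // d sigma _ s0.
have [k _ kE] := @eq_bigmax _ _ _ 0 (ord0 : 'I_d.+1) xpredT
  (fun i : 'I_d.+1 => sigma i * Num.sqrt (ln i.+2%:R)) isT
  (fun i _ => mulr_ge0 (ltW (s0 i)) (sqrtr_ge0 _)).
by exists k.
Qed.

Lemma risk_ge (R : realType) d (sigma : 'I_d -> R) (c eps : R) (psi : test R d) :
  (0 < d)%N -> (forall i j : 'I_d, (i <= j)%N -> sigma j <= sigma i) ->
  (forall i : 'I_d, 0 < sigma i) ->
  0 < c -> c <= 1 -> 0 < eps -> eps <= c * rho sigma ->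
  ((1 - c)%:E <= risk psi eps 1 sigma)%E.
Proof.
move=> d0 mono s0 c0 c1 eps0; have [k ->] := rho_attained d0 s0 => heps.
(* Only the indices up to [k] carry spikes; by [mono] their standard deviations are at least
   sigma_k. *)
pose th (a : 'I_k.+1) := spike eps (widen_ord (ltn_ord k) a).
have sN0 i : sigma i != 0 by rewrite gt_eqF.
have mpsi b : measurable (psi @^-1` [set b]).
  by rewrite -[X in measurable X]setTI; exact: measurable_funP.
have chi2 : \sum_(a < k.+1) \sum_(b < k.+1)
    expR (\sum_(i < d) tnth (th a) i * tnth (th b) i / sigma i ^+ 2) <=
    (1 + c ^+ 2) * k.+1%:R ^+ 2.
  (* The exponent is at most c^2 ln(1 + (k + 1)), so Bernoulli applies with a = c^2 and x = k +
     1. *)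
  have peak a : expR (eps ^+ 2 / sigma (widen_ord (ltn_ord k) a) ^+ 2) <=
      1 + c ^+ 2 * k.+1%:R.
    have l0 : 0 <= ln (k.+2%:R : R) by rewrite ln_ge0// ler1n.
    apply: le_trans (@expR_ln1D_le R (c ^+ 2) k.+1%:R _ _ _) => //.
    - rewrite ler_expR nat1r ler_pdivrMr ?exprn_gt0//.
      apply: (@le_trans _ _ (c ^+ 2 * ln k.+2%:R * sigma k ^+ 2)).
        rewrite -[ln _]sqr_sqrtr// -!exprMn ler_sqr ?nnegrE ?(ltW eps0)//.
          by rewrite -mulrA [_ * sigma k]mulrC.
        by rewrite !mulr_ge0 ?sqrtr_ge0// ltW.
      rewrite (ler_wpM2l (mulr_ge0 (sqr_ge0 c) l0))// ler_sqr ?nnegrE ?(ltW (s0 _))//.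
      by apply: mono; rewrite /= -ltnS.
    - exact: sqr_ge0.
    - by rewrite expr_le1// ltW.
  (* Each row has one diagonal term, bounded by [peak], and k off-diagonal terms equal to exp 0 = 1,
     since distinct spikes have disjoint supports. *)
  apply: (@le_trans _ _ (\sum_(a < k.+1) (k.+1%:R + c ^+ 2 * k.+1%:R))).
    apply: ler_sum => a _; rewrite (bigD1 a)//= spike_dot eqxx.
    under eq_bigr => b ab.
      rewrite spike_dot ifF ?expR0; last first.
        by apply/negbTE; apply: contra ab => /eqP/(congr1 val)/= ab; apply/eqP/esym/val_inj.
      over.
    rewrite sumr_const cardC1 card_ord -[k.+1%:R in leRHS]nat1r.
    by have := peak a; rewrite -nat1r; lra.
  by rewrite sumr_const card_ord -mulr_natr; lra.
have := mixture_testing (theta := th) (ltn0Sn k) sN0 c0 (mpsi false) chi2.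
move/le_trans; apply; rewrite /risk leeD//.
  rewrite (_ : ~` _ = psi @^-1` [set true])//.
  by apply/seteqP; split=> x /=; case: (psi x).
(* The average error over the spikes is at most the supremum over [Theta eps 1], which contains each
   of them. *)
rewrite lee_pdivrMl ?ltr0n//.
rewrite [leRHS](_ : _ = \sum_(a < k.+1)
    ereal_sup [set gaussian_law sigma theta (psi @^-1` [set false]) |
      theta in Theta eps 1])%E.
  apply: lee_sum => a _; apply: ereal_sup_ubound.
  by exists (th a) => //; exact: Theta_spike.
by rewrite sumr_const card_ord mule_natl.
Qed.

(** Below c rho every test has risk at least 1 - c > eta, so no such radius is admissible in the
    infimum. *)
Lemma critical_radius_ge (R : realType) d (sigma : 'I_d -> R) (eta c : R) :
  (0 < d)%N -> (forall i j : 'I_d, (i <= j)%N -> sigma j <= sigma i) ->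
  (forall i : 'I_d, 0 < sigma i) -> 0 < c -> c <= 1 -> eta < 1 - c ->
  ((c * rho sigma)%:E <= critical_radius eta 1 sigma)%E.
Proof.
move=> d0 mono s0 c0 c1 etac; apply: le_ereal_inf_tmp => _ [eps [eps0 hR] <-].
rewrite lee_fin leNgt; apply/negP => heps.
have : ((1 - c)%:E <= minimax_risk eps 1 sigma)%E.
  by apply: le_ereal_inf_tmp => _ [psi _ <-]; apply: risk_ge => //; exact: ltW.
by move=> /le_trans /(_ hR); rewrite lee_fin leNgt etac.
Qed.

(** * Choice of the constants and conclusion *)

Unset Implicit Arguments.

Theorem theorem4 (R : realType) (eta : R) (heta0 : 0 < eta) (heta1 : eta < 1) :
  exists c C C' : R, [/\ 0 < c, 0 < C, 0 < C' &
    forall (d : nat) (sigma : 'I_d -> R),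
      (0 < d)%N ->
      (forall i j : 'I_d, (i <= j)%N -> sigma j <= sigma i) ->
      (forall i : 'I_d, 0 < sigma i) ->
      ((c * rho sigma)%:E <= critical_radius eta 1 sigma)%E /\
      (forall s : nat, (1 <= s <= d)%N ->
        let psi : test R d := max_test (C * rho sigma) in
        (gaussian_law sigma (vec0 R d) (psi @^-1` [set true]) <= (eta / 2)%:E)%E /\
        (forall theta : d.-tuple R,
          C' * rho sigma <= norm_inf theta -> (norm_zero theta <= s)%N ->
          (gaussian_law sigma theta (psi @^-1` [set false]) <= (eta / 2)%:E)%E))].
Proof.
(* Since 2^k >= k, any k > 4 / eta makes both error bounds 2 * 2^-k at most eta / 2. *)
have [k hk] : exists k : nat, 2 * 2 ^- k <= eta / 2.
  exists (Num.bound (4 / eta)).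
  have h4 : 0 <= 4 / eta by rewrite divr_ge0// ltW.
  have := archi_boundP h4; set k := Num.bound _ => hb.
  have h2 : (k%:R : R) <= 2 ^+ k by rewrite -natrX ler_nat ltnW// ltn_expl.
  have {}hb := lt_le_trans hb h2; move: hb.
  rewrite ltr_pdivrMr// => hb; rewrite ler_pdivrMr ?exprn_gt0//; nra.
have C0 : 0 < Num.sqrt ((k.+2 * 2)%:R : R) by rewrite sqrtr_gt0 ltr0n.
(* The first constant gives 1 - c = (1 + eta) / 2 > eta, as [critical_radius_ge] requires. *)
exists ((1 - eta) / 2), (Num.sqrt (k.+2 * 2)%:R), (2 * Num.sqrt (k.+2 * 2)%:R).
split=> //; first by lra.
move=> d sigma d0 mono s0; split; first by apply: critical_radius_ge => //; lra.
move=> s _ psi; split=> [|theta htheta _].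
  by apply: le_trans (max_test_type1 k s0) _; rewrite lee_fin.
by apply: le_trans (max_test_type2 d0 s0 htheta) _; rewrite lee_fin.
Qed.
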